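(* Let $\mathbb{U}$ be an Absolute Universe of combinatorial games and let $G,H\in\mathbb{U}$. Then $G\succcurlyeq H$ (modulo $\mathbb{U}$) if and only if $[G,H]\in \mathrm{Proviso}(\mathbb{U})$ and the Left Provisional Game $[G,H]$, regarded as a normal-play game, satisfies $[G,H]\geq 0$ (that is, Left wins $[G,H]$ under normal play when Right starts).
   Context: **Free space.** Let $(\mathbb{A},+)$ be a totally ordered additive group. A game $G=\langle G^{\mathcal L}\mid G^{\mathcal R}\rangle$ is given by its Left and Right options. If Left has no options we write $G^{\mathcal L}=\emptyset^{\ell}$ for some $\ell\in\mathbb{A}$ (an atom with adorn $\ell$) and $G$ is called left-atomic; if Right has no options we write $G^{\mathcal R}=\emptyset^{r}$, $r\in\mathbb{A}$, and $G$ is called right-atomic. A typical Left (Right) option is denoted $G^L$ ($G^R$). Let $\Omega_0=\{\langle\emptyset^\ell\mid\emptyset^r\rangle:\ell,r\in\mathbb{A}\}$; for $n>0$, $\Omega_n$ is the set of all games with finite sets of options in $\Omega_{n-1}$, including games that are left- and/or right-atomic. The free space is $\Omega=\bigcup_{n\ge0}\Omega_n$. Games are literal forms (trees). **Disjunctive sum.** $G+H$ is defined recursively. If $G$ and $H$ are both left-atomic with adorns $\ell_1,\ell_2$, then $G+H$ is left-atomic with adorn $\ell_1+\ell_2$; otherwise its Left options are all $G^L+H$ and all $G+H^L$. If $G$ and $H$ are both right-atomic with adorns $r_1,r_2$, then $G+H$ is right-atomic with adorn $r_1+r_2$; otherwise its Right options are all $G^R+H$ and all $G+H^R$. **Game space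 and outcomes.** A combinatorial game space consists of $\Omega$ with $+$, a totally ordered set $\mathbb{S}$ of results, and order-preserving maps $\nu_L,\nu_R:\mathbb{A}\to\mathbb{S}$, where $\nu_L=\nu_R$ is required if $|\mathbb{A}|>1$. It is assumed that $\mathbb{S}=\nu_L(\mathbb{A})\cup\nu_R(\mathbb{A})$. The outcome functions $o_L,o_R:\Omega\to\mathbb{S}$ are: $o_L(G)=\nu_L(\ell)$ if $G^{\mathcal L}=\emptyset^\ell$, and $o_L(G)=\max o_R(G^L)$ over all Left options otherwise; $o_R(G)=\nu_R(r)$ if $G^{\mathcal R}=\emptyset^r$, and $o_R(G)=\min o_L(G^R)$ over all Right options otherwise. **Conjugate.** $\overset{\leftrightarrow}{G}$ is obtained recursively by swapping Left and Right: its Left options are the conjugates of the Right options of $G$ (or the atom $\emptyset^{-r}$ if $G^{\mathcal R}=\emptyset^r$), and its Right options are the conjugates of the Left options of $G$ (or the atom $\emptyset^{-\ell}$ if $G^{\mathcal L}=\emptyset^\ell$). **Absolute Universe.** A universe $\mathbb{U}\subseteq\Omega$ is a set of games containing $\langle\emptyset^a\mid\emptyset^a\rangle$ for all $a\in\mathbb{A}$, and closed under taking options, under disjunctive sum, and under conjugation. It is parental if $\langle\mathcal A\mid\mathcal B\rangle\in\mathbb{U}$ for all finite non-empty $\mathcal A,\mathcal B\subset\mathbb{U}$. It is dense if for all $G\in\mathbb{U}$ and all $x,y\in\mathbb{S}$ there is $H\in\mathbb{U}$ with $o_L(G+H)=x$ and $o_R(G+H)=y$. An Absolute Universe is a universe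 that is both parental and dense. **Order.** For $G,H\in\mathbb{U}$, $G\succcurlyeq H$ (modulo $\mathbb{U}$) means that $o_L(G+X)\geq o_L(H+X)$ and $o_R(G+X)\geq o_R(H+X)$ for all $X\in\mathbb{U}$. **Proviso.** $[G,H]\in\mathrm{Proviso}(\mathbb{U})$ means: $o_L(G+X)\geq o_L(H+X)$ for all left-atomic $X\in\mathbb{U}$, and $o_R(G+X)\geq o_R(H+X)$ for all right-atomic $X\in\mathbb{U}$. **Left Provisional Game (LPG).** Its positions are ordered pairs $[G,H]\in\mathbb{U}\times\mathbb{U}$. The Left options of $[G,H]$ are those pairs $[G^L,H]$ ($G^L$ a Left option of $G$) and $[G,H^R]$ ($H^R$ a Right option of $H$) which lie in $\mathrm{Proviso}(\mathbb{U})$. The Right options of $[G,H]$ are all pairs $[G^R,H]$ and $[G,H^L]$ (no restriction). Players alternate, and a player who cannot move loses. Thus $[G,H]$ is a normal-play game, for every $\mathbb{U}$.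
   Formalization: The set of results S is assumed to have at least two elements; if S has only one, all games are equal modulo U, and the claim fails for G with single Left and Right option 0 and H = 0. *)

(* Defs.v *)
From HB Require Import structures.
From mathcomp Require Import all_boot all_order all_algebra.
From mathcomp Require Import boolp classical_sets.

Set Implicit Arguments.
Unset Strict Implicit.
Unset Printing Implicit Defensive.

Import Order.TTheory GRing.Theory.
Local Open Scope ring_scope.

(* [porderZmodType] has no axiom relating the order to the addition.  The
   trivial group, whose only element is 0, is allowed. *)
HB.mixin Record isTotallyOrderedGroup (A : Type) of Num.POrderedZmodule A := {
  adorn_le_total : forall x y : A, (x <= y) || (y <= x);
  adorn_leD2r : forall z x y : A, x <= y -> x + z <= y + z
}.

#[short(type="orderedGroupType")]
HB.structure Definition OrderedGroup :=
  { A of Num.POrderedZmodule A & isTotallyOrderedGroup A }.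

(* [Opts G s] is the finite non-empty set whose elements are G and the members
   of s.  The order and the repetitions of this enumeration are irrelevant:
   see [same_form]. *)
Inductive game (A : Type) : Type := Game of side A & side A
with side (A : Type) : Type := Atom of A | Opts of game A & seq (game A).

HB.instance Definition _ (A : Type) := gen_eqMixin (game A).
HB.instance Definition _ (A : Type) := gen_choiceMixin (game A).

Section Games.
Context {A : Type}.
Implicit Types G : game A.

Definition left_side G := let: Game l _ := G in l.
Definition right_side G := let: Game _ r := G in r.

Definition opts (s : side A) : seq (game A) :=
  if s is Opts G t then G :: t else [::].

Definition left_opts G := opts (left_side G).
Definition right_opts G := opts (right_side G).

Definition left_atomic G := exists l, left_side G = Atom l.
Definition right_atomic G := exists r, right_side G = Atom r.

End Games.

(* Equality of literal forms once the lists of options are read as sets. *)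
Fixpoint same_form (A : eqType) (G H : game A) {struct G} : bool :=
  let same_side (s t : side A) : bool :=
    match s, t with
    | Atom a, Atom b => a == b
    | Opts G0 s', Opts H0 t' =>
        let us := H0 :: t' in
        [&& has (same_form G0) us,
            all (fun K => has (same_form K) us) s' &
            all (fun K' => same_form G0 K' || has (fun K => same_form K K') s')
                us]
    | _, _ => false
    end in
  let: Game Gl Gr := G in
  let: Game Hl Hr := H in
  same_side Gl Hl && same_side Gr Hr.

Fixpoint game_add (A : zmodType) (G : game A) {struct G} : game A -> game A :=
  fix addG (H : game A) {struct H} : game A :=
    let: Game Gl Gr := G in
    let: Game Hl Hr := H in
    let add_side (s t : side A) : side A :=
      match s, t with
      | Atom a, Atom b => Atom (a + b)
      | Atom _, Opts H0 t' => Opts (addG H0) (map addG t')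
      | Opts G0 s', _ =>
          Opts (game_add G0 H)
            (map (fun K => game_add K H) s' ++
             if t is Opts H0 t' then addG H0 :: map addG t' else [::])
      end in
    Game (add_side Gl Hl) (add_side Gr Hr).

Fixpoint conjugate (A : zmodType) (G : game A) : game A :=
  let conj_side (s : side A) : side A :=
    match s with
    | Atom a => Atom (- a)
    | Opts G0 s' => Opts (conjugate G0) (map (@conjugate A) s')
    end in
  let: Game Gl Gr := G in Game (conj_side Gr) (conj_side Gl).

(* A one-element S is not excluded here; there every universe is dense and all
   games are equal modulo it, so results separating games need two results. *)
Record game_space (A : orderedGroupType) (d : Order.disp_t) (S : orderType d) :=
  GameSpace {
    nuL : A -> S;
    nuR : A -> S;
    nuL_homo : {homo nuL : x y / (x <= y)%R >-> (x <= y)%O};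
    nuR_homo : {homo nuR : x y / (x <= y)%R >-> (x <= y)%O};
    nu_eq : (exists a b : A, a != b) -> nuL =1 nuR;
    nu_surj : forall s : S, (exists a, s = nuL a) \/ (exists a, s = nuR a)
  }.

Section Outcomes.
Context {A : orderedGroupType} {d : Order.disp_t} {S : orderType d}.
Context (sp : game_space A S).
Implicit Types (G H X : game A) (U : set (game A)).

Fixpoint oL G : S :=
  match G with
  | Game (Atom l) _ => nuL sp l
  | Game (Opts G0 s) _ => foldr Order.max (oR G0) (map oR s)
  end
with oR G : S :=
  match G with
  | Game _ (Atom r) => nuR sp r
  | Game _ (Opts G0 s) => foldr Order.min (oL G0) (map oL s)
  end.

(* [univ_same_form] makes U a set of literal forms, i.e. a subset of the free
   space, rather than a set of enumerations of literal forms. *)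
Record universe U : Prop := Universe {
  univ_same_form : forall G H, same_form G H -> U G -> U H;
  univ_atoms : forall a : A, U (Game (Atom a) (Atom a));
  univ_left_opts : forall G GL, U G -> GL \in left_opts G -> U GL;
  univ_right_opts : forall G GR, U G -> GR \in right_opts G -> U GR;
  univ_add : forall G H, U G -> U H -> U (game_add G H);
  univ_conj : forall G, U G -> U (conjugate G)
}.

Definition parental U := forall (G : game A) s (H : game A) t,
  {in G :: s, forall K, U K} -> {in H :: t, forall K, U K} ->
  U (Game (Opts G s) (Opts H t)).

Definition dense U := forall G (x y : S), U G ->
  exists H, [/\ U H, oL (game_add G H) = x & oR (game_add G H) = y].

Definition absolute_universe U := [/\ universe U, parental U & dense U].

Definition game_ge U G H := forall X, U X ->
  (oL (game_add H X) <= oL (game_add G X))%O /\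
  (oR (game_add H X) <= oR (game_add G X))%O.

Definition proviso U (p : game A * game A) :=
  (forall X, U X -> left_atomic X ->
     (oL (game_add p.2 X) <= oL (game_add p.1 X))%O) /\
  (forall X, U X -> right_atomic X ->
     (oR (game_add p.2 X) <= oR (game_add p.1 X))%O).

(* When G and H lie in a universe, so do all the components below, by closure
   under options. *)
Definition lpg_left U (p q : game A * game A) :=
  ((exists2 GL, GL \in left_opts p.1 & q = (GL, p.2)) \/
   (exists2 HR, HR \in right_opts p.2 & q = (p.1, HR))) /\
  proviso U q.

Definition lpg_right (p q : game A * game A) :=
  (exists2 GR, GR \in right_opts p.1 & q = (GR, p.2)) \/
  (exists2 HL, HL \in left_opts p.2 & q = (p.1, HL)).

End Outcomes.

(* Normal play (a player who cannot move loses) on a set P of positions with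
   moves [lmove] and [rmove].  [np_ge0 p]: Left wins p when Right starts;
   [np_left_wins_first p]: Left wins p when Left starts. *)
Inductive np_ge0 (P : Type) (lmove rmove : P -> P -> Prop) (p : P) : Prop :=
| NpGe0 of forall q, rmove p q -> np_left_wins_first lmove rmove q
with np_left_wins_first (P : Type) (lmove rmove : P -> P -> Prop) (p : P) : Prop :=
| NpLeftWinsFirst q of lmove p q & np_ge0 lmove rmove q.

(* Main.v *)
Require Import Defs.
From mathcomp Require Import all_boot all_order all_algebra.
From mathcomp Require Import boolp classical_sets.

(** From the provisional game to the order: Left plays G + X by copying her
    strategy in the provisional game (G, H) and, in X, the moves that are good
    for her in H + X.  The proviso settles the positions in which the player
    to move has no move in X.  This is [np_ge0_game_ge], an induction on the
    total size of G, H and X.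

    From the order to the provisional game: it is enough to find, after each
    move of Right from (G, H) with G >= H to some (K, L), a reply of Left to a
    pair whose first component is >= the second, for such a pair satisfies the
    proviso and the argument can be repeated.  If there is no such reply, that
    is if no left option of K is >= L and K is >= no right option of L, then
    the finitely many
    witnesses of these failures are assembled into one game T, whose left
    options answer the right options of L and whose right options answer the
    left options of K, with oL (K + T) < oR (L + T) ([downlink]).  Since (K, L)
    was reached from (G, H) by a move of Right, T refutes G >= H.

    For T to work, all the failures must be witnessed at the same result s,
    in the sense that one outcome is < s and the other is >= s.  There are two
    obstacles.  First, a witness may concern the wrong one of the two outcomes
    oL and oR; parentality and density let one pass from either to the other
    ([separated_of_left], [separated_left_of]).  Second, the map from adorns to
    results need not be injective, so a witness at one threshold does not
    translate into a witness at a prescribed other one.  But adding a number c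
    to a witness translates both underlying adorns by c, so a threshold t can
    be replaced by s as soon as every pair of adorns that t separates has a
    translate that s separates.  Of any two thresholds one is finer than the
    other in this sense: the translations stabilizing an up-set of adorns form
    a convex subgroup, and the convex subgroups of a totally ordered group form
    a chain.  Hence the finest of finitely many thresholds serves for all the
    failures ([common_threshold]). *)

Set Implicit Arguments.
Unset Strict Implicit.
Unset Printing Implicit Defensive.

Import Order.TTheory GRing.Theory.
Local Open Scope ring_scope.

Local Notation "G :+ H" := (game_add G H) (at level 50, left associativity).

(** * Finite lists *)

(** Lists the finitely many replies to the elements of [xs], so that they can
    serve as the options of a game. *)
Lemma seq_choice (T T' : eqType) (P : T -> T' -> Prop) (xs : seq T) :
  (forall x, x \in xs -> exists y, P x y) ->
  exists ys : seq T', (forall y, y \in ys -> exists2 x, x \in xs & P x y) /\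
                      (forall x, x \in xs -> exists2 y, y \in ys & P x y).
Proof.
elim: xs => [|x xs IH] hxs; first by exists [::].
have [z hz|ys [ysP xsP]] := IH; first by apply: hxs; rewrite inE hz orbT.
have [y Pxy] := hxs x (mem_head _ _).
exists (y :: ys); split=> z; rewrite inE => /predU1P[->|hz].
- by exists x; rewrite ?mem_head.
- by have [w hw Pwz] := ysP z hz; exists w; rewrite // inE hw orbT.
- by exists y; rewrite ?mem_head.
- by have [w hw Pzw] := xsP z hz; exists w; rewrite // inE hw orbT.
Qed.

Lemma seq_extremum (T : eqType) (V : Type) (r : V -> V -> Prop)
    (Q : T -> V -> Prop) (xs : seq T) :
  (forall u v, r u v \/ r v u) ->
  (forall u v w, r u v -> r v w -> r u w) ->
  xs != [::] -> (forall x, x \in xs -> exists v, Q x v) ->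
  exists x v, [/\ x \in xs, Q x v &
    forall y, y \in xs -> exists2 w, Q y w & r w v].
Proof.
move=> rT rtr; have rr u : r u u by case: (rT u u).
elim: xs => // x xs IH _ hxs.
have [v Qv] := hxs x (mem_head _ _).
have [->|xs0] := eqVneq xs [::].
  exists x, v; split=> [||y]; rewrite ?mem_head // inE => /eqP ->.
  by exists v.
have [//|z hz|y [w [ys Qw wmax]]] := IH; first by apply: hxs; rewrite inE hz orbT.
case: (rT v w) => hvw.
  exists y, w; split=> // [|z]; first by rewrite inE ys orbT.
  by rewrite inE => /predU1P[->|/wmax//]; exists v.
exists x, v; split=> // [|z]; first by rewrite mem_head.
rewrite inE => /predU1P[->|/wmax[u Qu huw]]; first by exists v.
by exists u => //; apply: rtr hvw.
Qed.

(** * Options of games and of sums *)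

Section Options.
Context {A : Type}.
Implicit Types G K : game A.

Fixpoint game_size G : nat :=
  let side_size s :=
    match s with
    | Atom _ => 0
    | Opts G0 s' => game_size G0 + sumn (map game_size s')
    end%N in
  let: Game l r := G in (side_size l + side_size r).+1.

Lemma size_in_opts (s : seq (game A)) K :
  K \in s -> (game_size K <= sumn (map game_size s))%N.
Proof.
elim: s => //= G s IH; rewrite inE => /predU1P[->|/IH hK].
  exact: leq_addr.
exact: leq_trans hK (leq_addl _ _).
Qed.

Lemma left_opts_size G K : K \in left_opts G -> (game_size K < game_size G)%N.
Proof.
case: G => [[l|G0 s] r] // /(@size_in_opts (G0 :: s)) hK.
by rewrite ltnS (leq_trans hK) // leq_addr.
Qed.

Lemma right_opts_size G K : K \in right_opts G -> (game_size K < game_size G)%N.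
Proof.
case: G => [l [r|G0 s]] // /(@size_in_opts (G0 :: s)) hK.
by rewrite ltnS (leq_trans hK) // leq_addl.
Qed.

Lemma left_atomicVopts G : left_atomic G \/ left_opts G != [::].
Proof. by case: G => [[l|G0 s] r]; [left; exists l | right]. Qed.

Lemma right_atomicVopts G : right_atomic G \/ right_opts G != [::].
Proof. by case: G => [l [r|G0 s]]; [left; exists r | right]. Qed.

End Options.

Section Sums.
Context {A : zmodType}.
Implicit Types G H K : game A.

Lemma left_opts_add G H :
  left_opts (G :+ H) =
  [seq K :+ H | K <- left_opts G] ++ [seq G :+ K | K <- left_opts H].
Proof.
by case: G H => [[a|G0 s] Gr] [[b|H0 t] Hr] //=; rewrite /left_opts /= cats0.
Qed.

Lemma right_opts_add G H :
  right_opts (G :+ H) =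
  [seq K :+ H | K <- right_opts G] ++ [seq G :+ K | K <- right_opts H].
Proof.
by case: G H => [Gl [a|G0 s]] [Hl [b|H0 t]] //=; rewrite /right_opts /= cats0.
Qed.

Lemma left_optsDl G H K : K \in left_opts G -> K :+ H \in left_opts (G :+ H).
Proof. by move=> hK; rewrite left_opts_add mem_cat (map_f (fun K => K :+ H)). Qed.

Lemma left_optsDr G H K : K \in left_opts H -> G :+ K \in left_opts (G :+ H).
Proof. by move=> hK; rewrite left_opts_add mem_cat map_f ?orbT. Qed.

Lemma right_optsDl G H K : K \in right_opts G -> K :+ H \in right_opts (G :+ H).
Proof. by move=> hK; rewrite right_opts_add mem_cat (map_f (fun K => K :+ H)). Qed.

Lemma right_optsDr G H K : K \in right_opts H -> G :+ K \in right_opts (G :+ H).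
Proof. by move=> hK; rewrite right_opts_add mem_cat map_f ?orbT. Qed.

(** The first alternative is a move in the left summand, the second a move in
    the right summand. *)
Variant sum_option_spec (Gs Hs : seq (game A)) G H : game A -> Prop :=
  | SumOptionL K of K \in Gs : sum_option_spec Gs Hs G H (K :+ H)
  | SumOptionR K of K \in Hs : sum_option_spec Gs Hs G H (G :+ K).

Lemma left_optsDP G H K : K \in left_opts (G :+ H) ->
  sum_option_spec (left_opts G) (left_opts H) G H K.
Proof.
by rewrite left_opts_add mem_cat => /orP[]/mapP[K' hK' ->]; constructor.
Qed.

Lemma right_optsDP G H K : K \in right_opts (G :+ H) ->
  sum_option_spec (right_opts G) (right_opts H) G H K.
Proof.
by rewrite right_opts_add mem_cat => /orP[]/mapP[K' hK' ->]; constructor.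
Qed.

End Sums.

(** * Outcomes *)

Section Outcomes.
Context {A : orderedGroupType} {d : Order.disp_t} {S : orderType d}.
Context (sp : game_space A S).
Implicit Types G H X K : game A.
Local Notation oL := (oL sp).
Local Notation oR := (oR sp).

Lemma le_foldr_max (x : S) (xs : seq S) :
  (forall y, y \in x :: xs -> (y <= foldr Order.max x xs)%O) /\
  foldr Order.max x xs \in x :: xs.
Proof.
elim: xs => [|y xs [IH1 IH2]] /=.
  by split=> [y|]; rewrite inE // => /eqP->.
split=> [z|].
  rewrite !inE => /or3P[/eqP->|/eqP->|hz]; rewrite le_max ?lexx //.
    by rewrite IH1 ?orbT ?mem_head.
  by rewrite IH1 ?orbT // inE hz orbT.
case: leP => _; last by rewrite !inE eqxx orbT.
by move: IH2; rewrite !inE => /orP[->|->]; rewrite ?orbT.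
Qed.

Lemma foldr_min_le (x : S) (xs : seq S) :
  (forall y, y \in x :: xs -> (foldr Order.min x xs <= y)%O) /\
  foldr Order.min x xs \in x :: xs.
Proof.
elim: xs => [|y xs [IH1 IH2]] /=.
  by split=> [y|]; rewrite inE // => /eqP->.
split=> [z|].
  rewrite !inE => /or3P[/eqP->|/eqP->|hz]; rewrite ge_min ?lexx //.
    by rewrite IH1 ?orbT ?mem_head.
  by rewrite IH1 ?orbT // inE hz orbT.
case: leP => _; first by rewrite !inE eqxx orbT.
by move: IH2; rewrite !inE => /orP[->|->]; rewrite ?orbT.
Qed.

Lemma oR_le_oL G K : K \in left_opts G -> (oR K <= oL G)%O.
Proof.
case: G => [[l|G0 s] r] // hK.
by apply: (le_foldr_max _ _).1; apply: (map_f oR (s := G0 :: s)).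
Qed.

Lemma oR_le_oL_right G K : K \in right_opts G -> (oR G <= oL K)%O.
Proof.
case: G => [[l|l0 l] [r|G0 s]] // hK;
by apply: (foldr_min_le _ _).1; apply: (map_f oL (s := G0 :: s)).
Qed.

Lemma oL_attained G :
  left_opts G != [::] -> exists2 K, K \in left_opts G & oL G = oR K.
Proof.
case: G => [[l|G0 s] r] // _.
exact: (mapP (f := oR) (s := G0 :: s) (le_foldr_max _ _).2).
Qed.

Lemma oR_attained G :
  right_opts G != [::] -> exists2 K, K \in right_opts G & oR G = oL K.
Proof.
case: G => [[l|l0 l] [r|G0 s]] // _;
exact: (mapP (f := oL) (s := G0 :: s) (foldr_min_le _ _).2).
Qed.

Lemma oL_atom G l : left_side G = Atom l -> oL G = nuL sp l.
Proof. by case: G => [? r] /= ->. Qed.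

Lemma oR_atom G r : right_side G = Atom r -> oR G = nuR sp r.
Proof. by case: G => [[l|l0 l] ?] /= ->. Qed.

(** * Shifting by an adorn *)

Definition number (a : A) : game A := Game (Atom a) (Atom a).

(** The options of G + (X + c) are indexed by pairs that do not depend on c, so
    that a best option can be chosen once for all numbers c. *)
Definition options_shift (f : game A -> seq (game A)) G X :=
  [seq (K, X) | K <- f G] ++ [seq (G, K) | K <- f X].

Lemma left_opts_shift G X c : left_opts (G :+ (X :+ number c)) =
  [seq p.1 :+ (p.2 :+ number c) | p <- options_shift left_opts G X].
Proof.
by rewrite !left_opts_add cats0 map_cat -!map_comp.
Qed.

Lemma right_opts_shift G X c : right_opts (G :+ (X :+ number c)) =
  [seq p.1 :+ (p.2 :+ number c) | p <- options_shift right_opts G X].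
Proof.
by rewrite !right_opts_add cats0 map_cat -!map_comp.
Qed.

Lemma game_addr0 G : G :+ number 0 = G.
Proof.
have [n] := ubnP (game_size G); elim: n G => // n IH G; rewrite ltnS => hn.
have IHl K : K \in left_opts G -> K :+ number 0 = K.
  by move=> /left_opts_size hK; apply/IH/(leq_trans hK).
have IHr K : K \in right_opts G -> K :+ number 0 = K.
  by move=> /right_opts_size hK; apply/IH/(leq_trans hK).
have map0 (s : seq (game A)) : {in s, forall K, K :+ number 0 = K} ->
    [seq K :+ number 0 | K <- s] = s by exact: map_id_in.
case: G IHl IHr {hn} => [[l|G0 s] [r|H0 t]] /= /map0/= IHl /map0/= IHr;
  rewrite ?addr0 ?cats0 //.
- by case: IHr => -> ->.
- by case: IHl => -> ->.
- by case: IHl => -> ->; case: IHr => -> ->.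
Qed.

(** The outcome of G + X is decided by an adorn e at a leaf, and adding the
    number c replaces e by e + c.  As nuL is monotone, an option whose adorn is
    the best remains a best option for every c. *)
Lemma outcome_shift (nuE : nuL sp =1 nuR sp) G X :
  (exists e, forall c, oL (G :+ (X :+ number c)) = nuL sp (e + c)) /\
  (exists e, forall c, oR (G :+ (X :+ number c)) = nuL sp (e + c)).
Proof.
have [n] := ubnP (game_size G + game_size X).
elim: n G X => // n IH G X; rewrite ltnS => hn.
split.
- case E: (options_shift left_opts G X) => [|p ps].
    case: G X E {hn} => [[a|? ?] Gr] [[b|? ?] Xr] // _.
    by exists (a + b) => c; rewrite -addrA.
  have ps0 : options_shift left_opts G X != [::] by rewrite E.
  have [|||q [e [hq qe emax]]] := @seq_extremum _ A (fun x y => x <= y)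
    (fun p e => forall c, oR (p.1 :+ (p.2 :+ number c)) = nuL sp (e + c))
    _ _ _ ps0.
  + by move=> u v; apply/orP/adorn_le_total.
  + by move=> u v w; apply: le_trans.
  + move=> q; rewrite mem_cat => /orP[]/mapP[K /left_opts_size hK ->] /=;
    by apply: (IH _ _ _).2; apply: leq_trans hn; rewrite ?ltn_add2r ?ltn_add2l.
  exists e => c; apply/le_anti/andP; split; last first.
    by rewrite -qe; apply: oR_le_oL; rewrite left_opts_shift; apply/mapP; exists q.
  have [|K] := @oL_attained (G :+ (X :+ number c)).
    by rewrite left_opts_shift E.
  rewrite left_opts_shift => /mapP[p' /emax[e' p'E le_e'] ->] ->.
  by rewrite p'E; exact/nuL_homo/adorn_leD2r.
- case E: (options_shift right_opts G X) => [|p ps].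
    case: G X E {hn} => [Gl [a|? ?]] [Xl [b|? ?]] // _.
    by exists (a + b) => c; rewrite (@oR_atom _ (a + (b + c))) // -nuE addrA.
  have ps0 : options_shift right_opts G X != [::] by rewrite E.
  have [|||q [e [hq qe emin]]] := @seq_extremum _ A (fun x y => y <= x)
    (fun p e => forall c, oL (p.1 :+ (p.2 :+ number c)) = nuL sp (e + c))
    _ _ _ ps0.
  + by move=> u v; apply/orP/adorn_le_total.
  + by move=> u v w vu wv; apply: le_trans vu.
  + move=> q; rewrite mem_cat => /orP[]/mapP[K /right_opts_size hK ->] /=;
    by apply: (IH _ _ _).1; apply: leq_trans hn; rewrite ?ltn_add2r ?ltn_add2l.
  exists e => c; apply/le_anti/andP; split.
    by rewrite -qe; apply: oR_le_oL_right; rewrite right_opts_shift; apply/mapP; exists q.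
  have [|K] := @oR_attained (G :+ (X :+ number c)).
    by rewrite right_opts_shift E.
  rewrite right_opts_shift => /mapP[p' /emin[e' p'E le_e'] ->] ->.
  by rewrite p'E; exact/nuL_homo/adorn_leD2r.
Qed.

End Outcomes.

(** * Separating games at a threshold *)

Section Universe.
Context {A : orderedGroupType} {d : Order.disp_t} {S : orderType d}.
Context (sp : game_space A S) (U : set (game A)).
Context (U_absolute : absolute_universe sp U).
Implicit Types (G H X Y K T : game A) (s t x : S).
Local Notation oL := (oL sp).
Local Notation oR := (oR sp).

Let univU : universe U. Proof. by case: U_absolute. Qed.
Let Uleft G K : U G -> K \in left_opts G -> U K := @univ_left_opts _ _ univU G K.
Let Uright G K : U G -> K \in right_opts G -> U K :=
  @univ_right_opts _ _ univU G K.

Lemma parental_game Y0 (ys : seq (game A)) X0 (xs : seq (game A)) :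
  U Y0 -> (forall Y, Y \in ys -> U Y) -> U X0 -> (forall X, X \in xs -> U X) ->
  U (Game (Opts Y0 ys) (Opts X0 xs)).
Proof.
move=> UY0 Uys UX0 Uxs; case: U_absolute => _ parU _.
by apply: parU => K; rewrite inE => /predU1P[->|]; auto.
Qed.

Lemma dense_game G x : U G -> exists X, [/\ U X, oL (G :+ X) = x & oR (G :+ X) = x].
Proof. by case: U_absolute => _ _ dU UG; apply: dU. Qed.

(** A failure of G >= H, witnessed by X at the threshold s. *)
Definition separated s G H :=
  exists2 X, U X & (oR (G :+ X) < s <= oR (H :+ X))%O.

Definition separated_left s G H :=
  exists2 X, U X & (oL (G :+ X) < s <= oL (H :+ X))%O.

(** Right gets the chance to move to X.  The left options of Z make sure that he
    gains nothing by moving in H instead: each is an answer to one of his moves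
    there, provided by density. *)
Lemma separated_of_left s G H : U H -> separated_left s G H -> separated s G H.
Proof.
move=> UH [X UX /andP[GX HX]].
have [K|ys [ysP HsP]] := @seq_choice _ _
    (fun K Y => U Y /\ (s <= oR (K :+ Y))%O) (right_opts H).
  move=> hK; have [Y [UY _ hY]] := dense_game s (Uright UH hK).
  by exists Y; rewrite hY.
(* Y0 only prevents Z from being atomic on that side. *)
have [Y0 [UY0 _ _]] := dense_game s UH.
pose Z := Game (Opts Y0 ys) (Opts X [::]).
have XZ : X \in right_opts Z by rewrite mem_head.
exists Z; first by apply: parental_game => // Y /ysP[? ? []].
apply/andP; split.
  exact: le_lt_trans (oR_le_oL_right _ (right_optsDr _ XZ)) GX.
have [|K /right_optsDP[] {}K hK ->] := @oR_attained _ _ _ sp (H :+ Z).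
- by rewrite right_opts_add; case: (map _ _).
- have [Y hY [_ sY]] := HsP K hK.
  apply: le_trans sY _; apply/oR_le_oL/left_optsDr.
  by rewrite inE hY orbT.
- by move: hK; rewrite inE => /eqP->.
Qed.

(** The mirror image of [separated_of_left]: Left may move to X, and each of her
    moves in G is answered by a right option of Z. *)
Lemma separated_left_of s G H : U G -> separated s G H -> separated_left s G H.
Proof.
move=> UG [X UX /andP[GX HX]].
have [K|ys [ysP GsP]] := @seq_choice _ _
    (fun K Y => U Y /\ (oL (K :+ Y) < s)%O) (left_opts G).
  move=> hK; have [Y [UY hY _]] := dense_game (oR (G :+ X)) (Uleft UG hK).
  by exists Y; rewrite hY.
(* Y0 only prevents Z from being atomic on that side. *)
have [Y0 [UY0 _ _]] := dense_game s UG.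
pose Z := Game (Opts X [::]) (Opts Y0 ys).
have XZ : X \in left_opts Z by rewrite mem_head.
exists Z; first by apply: parental_game => // Y /ysP[? ? []].
apply/andP; split; last first.
  exact: le_trans HX (oR_le_oL _ (left_optsDr _ XZ)).
have [|K /left_optsDP[] {}K hK ->] := @oL_attained _ _ _ sp (G :+ Z).
- by rewrite left_opts_add; case: (map _ _).
- have [Y hY [_ sY]] := GsP K hK.
  apply: le_lt_trans sY; apply/oR_le_oL_right/right_optsDr.
  by rewrite inE hY orbT.
- by move: hK; rewrite inE => /eqP->.
Qed.

Lemma not_game_ge_separated G H :
  U H -> ~ game_ge sp U G H -> exists s, separated s G H.
Proof.
move=> UH; apply: contra_notP => nsep X UX.
split; rewrite leNgt; apply/negP => lt_o; apply: nsep.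
- exists (oL (H :+ X)); apply: separated_of_left => //.
  by exists X; rewrite // lt_o lexx.
- by exists (oR (H :+ X)); exists X; rewrite // lt_o lexx.
Qed.

(** Every pair of adorns separated by the cut at t has a translate separated by
    the cut at s; equivalently, the stabilizer of the cut at s is contained in
    that of the cut at t. *)
Definition finer s t := forall f e : A, (nuL sp f < t <= nuL sp e)%O ->
  exists c, (nuL sp (f + c) < s <= nuL sp (e + c))%O.

(** If no translate of f < e is separated by the cut at s, then subtracting
    e - f never leaves the set above s, so any pair f' < e' separated by s is
    at a distance greater than e - f; translating e' onto e then brings f' below
    f, which is below t. *)
Lemma finer_total s t : finer s t \/ finer t s.
Proof.
have [|nst] := pselect (finer s t); [by left | right].
have [f [e [/andP[ft te] cst]]] : exists f e, (nuL sp f < t <= nuL sp e)%O /\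
    forall c, (s <= nuL sp (e + c))%O -> (s <= nuL sp (f + c))%O.
  apply: contra_notP nst => nex f e fte.
  apply: contra_notP nex => nc; exists f, e; split=> // c sec.
  by rewrite leNgt; apply/negP => fcs; apply: nc; exists c; rewrite fcs.
move=> f' e' /andP[f's se']; exists (e - e').
rewrite [e' + _]addrC subrK te andbT; apply: le_lt_trans ft.
apply: nuL_homo.
have : f' <= f + (e' - e).
  have /orP[//|le_f'] := adorn_le_total f' (f + (e' - e)).
  have := le_lt_trans (nuL_homo sp le_f') f's.
  by rewrite ltNge cst // addrC subrK.
by move/(@adorn_leD2r A (e - e')); rewrite -addrA -(opprB e e') addNr addr0.
Qed.

Lemma separated_finer s t G H : nuL sp =1 nuR sp ->
  finer s t -> separated t G H -> separated s G H.
Proof.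
move=> nuE st [X UX].
have [_ [f fE]] := outcome_shift nuE G X.
have [_ [e eE]] := outcome_shift nuE H X.
rewrite -(game_addr0 X) fE eE !addr0 => /st[c fec].
exists (X :+ number c); last by rewrite fE eE.
by apply: univ_add => //; apply: univ_atoms.
Qed.

(** If A has two elements, nuL = nuR and the cuts are compared by [finer].  If A
    is trivial, S has at most the two elements nuL 0 and nuR 0, and only the
    larger one can be a threshold that separates anything. *)
Lemma separated_total s t :
  (forall G H, separated s G H -> separated t G H) \/
  (forall G H, separated t G H -> separated s G H).
Proof.
have [A2|A1] := pselect (exists a b : A, a != b).
  have [st|ts] := finer_total s t; [right|left] => G H;
  by apply: separated_finer => //; apply: nu_eq.
have a0 (a : A) : a = 0 by apply/eqP; apply: contra_notT A1 => ?; exists a, 0.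
have S2 u : u = nuL sp 0 \/ u = nuR sp 0.
  by case: (nu_surj sp u) => -[a]; rewrite (a0 a); auto.
have [|nst] := pselect (forall G H, separated s G H -> separated t G H);
  first by left.
right=> G H [X UX /andP[/le_lt_trans lt_t _]].
exfalso; apply: nst => G' H' [X' UX' h]; exists X' => //.
case/andP: (h) => /le_lt_trans lt_s _.
have {lt_t} xt := lt_t _ (lexx _); have {lt_s} ys := lt_s _ (lexx _).
suff -> : t = s by [].
move: (oR _) (oR _) xt ys => x y.
case: (S2 s) (S2 t) (S2 x) (S2 y) => -> [] -> [] -> [] -> //;
  rewrite ?ltxx // => h1 h2; have := lt_trans h1 h2; rewrite ltxx //.
Qed.

Lemma common_threshold (ps : seq (game A * game A)) :
  (exists s t : S, (s < t)%O) ->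
  (forall p, p \in ps -> exists s, separated s p.1 p.2) ->
  exists x s, (x < s)%O /\ forall p, p \in ps -> separated s p.1 p.2.
Proof.
move=> [x [y xy]] hps; have [->|ps0] := eqVneq ps [::].
  by exists x, y.
have [u v w uv vw G H /uv/vw//|p [s [_ [X _ /andP[lt_s _]] smax]]] :=
  @seq_extremum _ _ _ (fun p s => separated s p.1 p.2) _ separated_total _ ps0 hps.
exists (oR (p.1 :+ X)), s; split=> // q /smax[t qt]; exact.
Qed.

(** The two failures of the order give, for each move of Left in G and each move of
    Right in H, a game separating at a common threshold s; these are the right
    and left options of T.  Left starting G + T stays below s: her moves in G
    are answered in T, and her moves in T leave a result below s.  Right starting H + T
    cannot prevent a result at least s, for the same reasons. *)
Lemma downlink G H :
  (exists s t : S, (s < t)%O) -> U G -> U H ->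
  (forall K, K \in left_opts G -> ~ game_ge sp U K H) ->
  (forall K, K \in right_opts H -> ~ game_ge sp U G K) ->
  exists2 T, U T & (oL (G :+ T) < oR (H :+ T))%O.
Proof.
move=> S2 UG UH nGH nHG.
have [|x [s [xs sep]]] := @common_threshold
  ([seq (K, H) | K <- left_opts G] ++ [seq (G, K) | K <- right_opts H]) S2.
  move=> p; rewrite mem_cat => /orP[]/mapP[K hK ->] /=.
    exact/not_game_ge_separated/nGH.
  by apply/not_game_ge_separated; [apply: Uright hK | apply: nHG].
have [K hK|Xs [XsP GXs]] := @seq_choice _ _ (fun K X =>
    U X /\ (oL (K :+ X) < s <= oL (H :+ X))%O) (left_opts G).
  have [|X UX hX] := @separated_left_of s K H (Uleft UG hK); last by exists X.
  by apply: (sep (K, H)); rewrite mem_cat map_f.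
have [K hK|Ys [YsP HYs]] := @seq_choice _ _ (fun K Y =>
    U Y /\ (oR (G :+ Y) < s <= oR (K :+ Y))%O) (right_opts H).
  have [|Y UY hY] := sep (G, K); last by exists Y.
  by rewrite mem_cat [X in _ || X]map_f ?orbT.
(* X0 and Y0 make both sides of T non-empty; x < s provides a result for Y0. *)
have [X0 [UX0 X0s _]] := dense_game s UH.
have [Y0 [UY0 _ Y0x]] := dense_game x UG.
pose T := Game (Opts Y0 Ys) (Opts X0 Xs).
exists T; first by apply: parental_game => // [Y /YsP[? ? []]|X /XsP[? ? []]].
apply: (@lt_le_trans _ _ s).
  have [|K /left_optsDP[] {}K hK ->] := @oL_attained _ _ _ sp (G :+ T).
  - by rewrite left_opts_add; case: (map _ _).
  - have [X hX [_ /andP[Xs' _]]] := GXs K hK.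
    apply: le_lt_trans Xs'; apply/oR_le_oL_right/right_optsDr.
    by rewrite inE hX orbT.
  - by move: hK; rewrite inE => /predU1P[->|/YsP[? ? [_ /andP[]]]]; rewrite ?Y0x.
have [|K /right_optsDP[] {}K hK ->] := @oR_attained _ _ _ sp (H :+ T).
- by rewrite right_opts_add; case: (map _ _).
- have [Y hY [_ /andP[_ sY]]] := HYs K hK.
  apply: le_trans sY _; apply/oR_le_oL/left_optsDr.
  by rewrite inE hY orbT.
- by move: hK; rewrite inE => /predU1P[->|/XsP[? ? [_ /andP[]]]]; rewrite ?X0s.
Qed.

(** * The order and the provisional game *)

(** Left answers every move of Right in G, and follows every good move in H + X,
    by the reply of the provisional game: a reply in G is played in G + X, while
    a reply in H is a move of Right in H + X, after which Left is guaranteed at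
    least the result that she was guaranteed before it. *)
Lemma np_ge0_game_ge G H : proviso sp U (G, H) ->
  np_ge0 (lpg_left sp U) lpg_right (G, H) -> game_ge sp U G H.
Proof.
move=> prov win X UX.
have [n] := ubnP (game_size G + game_size H + game_size X).
elim: n G H X prov win UX => // n IH G H X [provL provR] [win] UX.
rewrite ltnS => hn; split.
- have [|X0] := left_atomicVopts X; first exact: provL.
  have [|K] := @oL_attained _ _ _ sp (H :+ X).
    by rewrite left_opts_add; case: (left_opts X) X0 => // ? ? _; case: (map _ _).
  case/left_optsDP=> {}K hK ->; last first.
    apply: le_trans (oR_le_oL _ (left_optsDr _ hK)).
    apply: (IH _ _ _ _ _ _ _).2 => //; first exact: Uleft hK.
    by apply: leq_trans hn; rewrite ltn_add2l left_opts_size.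
  have [|q [[[GL hGL ->]|[HR hHR ->]] provq] winq] := win (G, K).
  + by right; exists K.
  + apply: le_trans (oR_le_oL _ (left_optsDl _ hGL)).
    apply: (IH _ _ _ _ _ _ _).2 => //; apply: leq_trans hn.
    by rewrite ltn_add2r -addSn leq_add ?left_opts_size // ltnW // left_opts_size.
  + apply: le_trans (oR_le_oL_right _ (right_optsDl _ hHR)) _.
    apply: (IH _ _ _ _ _ _ _).1 => //; apply: leq_trans hn.
    rewrite ltn_add2r ltn_add2l (ltn_trans (right_opts_size hHR)) //.
    exact: left_opts_size.
- have [|X0] := right_atomicVopts X; first exact: provR.
  have [|K] := @oR_attained _ _ _ sp (G :+ X).
    by rewrite right_opts_add; case: (right_opts X) X0 => // ? ? _; case: (map _ _).
  case/right_optsDP=> {}K hK ->; last first.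
    apply: le_trans (oR_le_oL_right _ (right_optsDr _ hK)) _.
    apply: (IH _ _ _ _ _ _ _).1 => //; first exact: Uright hK.
    by apply: leq_trans hn; rewrite ltn_add2l right_opts_size.
  have [|q [[[GL hGL ->]|[HR hHR ->]] provq] winq] := win (K, H).
  + by left; exists K.
  + apply: le_trans (oR_le_oL _ (left_optsDl _ hGL)).
    apply: (IH _ _ _ _ _ _ _).2 => //; apply: leq_trans hn.
    rewrite ltn_add2r ltn_add2r (ltn_trans (left_opts_size hGL)) //.
    exact: right_opts_size.
  + apply: le_trans (oR_le_oL_right _ (right_optsDl _ hHR)) _.
    apply: (IH _ _ _ _ _ _ _).1 => //; apply: leq_trans hn.
    by rewrite ltn_add2r -addSn leq_add ?right_opts_size // ltnW // right_opts_size.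
Qed.

Lemma game_ge_proviso G H : game_ge sp U G H -> proviso sp U (G, H).
Proof. by move=> GH; split=> X UX _; case: (GH X UX). Qed.

(** The hypothesis on T is what remains of G' >= H' when (G, H) arises from
    (G', H') by one move of Right. *)
Lemma left_reply G H : (exists s t : S, (s < t)%O) -> U G -> U H ->
  (forall T, U T -> (oR (H :+ T) <= oL (G :+ T))%O) ->
  (exists2 K, K \in left_opts G & game_ge sp U K H) \/
  (exists2 K, K \in right_opts H & game_ge sp U G K).
Proof.
move=> S2 UG UH noT.
have [|nG] := pselect (exists2 K, K \in left_opts G & game_ge sp U K H);
  first by left.
right; apply: contrapT => nH.
have [K hK GH|K hK GH|T UT] := @downlink G H S2 UG UH.
- by apply: nG; exists K.
- by apply: nH; exists K.
- by rewrite ltNge noT.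
Qed.

Lemma game_ge_np_ge0 G H : (exists s t : S, (s < t)%O) -> U G -> U H ->
  game_ge sp U G H -> np_ge0 (lpg_left sp U) lpg_right (G, H).
Proof.
move=> S2.
have [n] := ubnP (game_size G + game_size H).
elim: n G H => // n IH G H; rewrite ltnS => hn UG UH GH.
have reply K L : U K -> U L ->
    (game_size K + game_size L < game_size G + game_size H)%N ->
    (forall T, U T -> (oR (L :+ T) <= oL (K :+ T))%O) ->
  np_left_wins_first (lpg_left sp U) lpg_right (K, L).
  move=> UK UL hKL noT.
  have [[M hM ML]|[M hM KM]] := left_reply S2 UK UL noT.
  - exists (M, L); first by split; [left; exists M | apply: game_ge_proviso].
    apply: IH => //; last exact: Uleft hM.
    apply: leq_trans hn; apply: leq_trans hKL; rewrite ltnS leq_add2r ltnW //.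
    exact: left_opts_size.
  - exists (K, M); first by split; [right; exists M | apply: game_ge_proviso].
    apply: IH => //; last exact: Uright hM.
    apply: leq_trans hn; apply: leq_trans hKL; rewrite ltnS leq_add2l ltnW //.
    exact: right_opts_size.
split=> q [[K hK ->]|[K hK ->]]; apply: reply => //=.
- exact: Uright hK.
- by rewrite ltn_add2r right_opts_size.
- move=> T UT; have [_ oRGH] := GH T UT; apply: le_trans oRGH _.
  exact/oR_le_oL_right/right_optsDl.
- exact: Uleft hK.
- by rewrite ltn_add2l left_opts_size.
- move=> T UT; have [oLGH _] := GH T UT; apply: le_trans oLGH.
  exact/oR_le_oL/left_optsDl.
Qed.

End Universe.

Theorem theorem2p5 (A : orderedGroupType) (d : Order.disp_t) (S : orderType d)
    (sp : game_space A S) (S_nontrivial : exists x y : S, x != y)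
    (U : set (game A)) (U_absolute : absolute_universe sp U)
    (G H : game A) (UG : U G) (UH : U H) :
  game_ge sp U G H <->
  proviso sp U (G, H) /\ np_ge0 (lpg_left sp U) lpg_right (G, H).
Proof.
split=> [GH|[prov win]]; last exact: (np_ge0_game_ge U_absolute).
split; first exact: game_ge_proviso.
apply: game_ge_np_ge0 => //.
have [x [y]] := S_nontrivial.
by rewrite neq_lt => /orP[] ?; [exists x, y | exists y, x].
Qed.
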